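(* Let $\Lambda\in\{-1,0,1\}$. An ideal tetrahedron in $\mathbb Y_\Lambda$ is determined up to isometries by its generalized dihedral angles: two ideal tetrahedra with the same generalized dihedral angles are isometric. If $I$ is an ideal tetrahedron with vertices $$y_1=\begin{pmatrix}1&0\\0&0\end{pmatrix},\quad y_2=\begin{pmatrix}0&0\\0&1\end{pmatrix},\quad y_3=\begin{pmatrix}1&1\\1&1\end{pmatrix},\quad y_4=\begin{pmatrix}|z|^2&z\\\overline z&1\end{pmatrix},\qquad z=-\frac{s_\Lambda(\beta)}{s_\Lambda(\alpha)}e^{\ell\gamma},$$ where $\alpha,\beta>0$, $\gamma=-(\alpha+\beta)$, and $\alpha+\beta<\pi$ if $\Lambda=1$, then its generalized dihedral angles are $\alpha$ and $\beta$ (interior angles) and $\alpha+\beta$ (exterior angle), with opposite edges having equal dihedral angles.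
   Context: $\mathbb C_\Lambda=\mathbb R[\ell]/(\ell^2+\Lambda)$, with $\overline{x+\ell y}=x-\ell y$, $|z|^2=z\overline z$; $e^{\ell\theta}=c_\Lambda(\theta)+\ell s_\Lambda(\theta)$, so $s_\Lambda=\sinh,\ \theta\mapsto\theta,\ \sin$ for $\Lambda=-1,0,1$. For $y\in\mathrm{Mat}(2,\mathbb C_\Lambda)$ let $y^\dagger$ be the conjugate transpose. $\mathbb Y_\Lambda=\{y:y^\dagger=y,\ \det y>0\}/\mathbb R^\times$ ($\mathrm{AdS}^3$, half-pipe space, $\mathbb H^3$ for $\Lambda=-1,0,1$), $\partial_\infty\mathbb Y_\Lambda=\{vv^\dagger:v\in\mathbb C_\Lambda^2,vv^\dagger\ne0\}/\mathbb R^\times$. $\mathrm{PGL}^+(2,\mathbb C_\Lambda)=\{B:|\det B|^2>0\}/\mathbb C_\Lambda^\times$ acts by $B\rhd y=ByB^\dagger$; isometries are the elements of the group generated by this action and entrywise conjugation. Geodesics are $t\mapsto B\rhd\exp(tY)$ with $Y^\dagger=Y\neq0$, $\mathrm{tr}Y=0$, spacelike iff $-\det Y>0$; geodesic planes are intersections of $\mathbb Y_\Lambda$ with projective planes of the projectivization of $\{y=y^\dagger\}\cong\mathbb R^4$, spacelike if all their geodesics are. An ideal tetrahedron is a non-degenerate convex geodesic 3-simplex (the set of points of $\mathbb Y_\Lambda$ represented by a cone $\{\sum_{i=1}^4b_iy_i':b_i\ge0,\sum b_i\ne0\}$ on four linearly independent vectors, all of whose elements outside the vertex rays represent points of $\mathbb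 Y_\Lambda$) with vertices in $\partial_\infty\mathbb Y_\Lambda$ and faces on spacelike planes. Generalized dihedral angles. Given an edge with ideal endpoints $p,q$ and the other two vertices $p',q'$, choose $B\in\mathrm{PGL}^+(2,\mathbb C_\Lambda)$ with $p=B\rhd\begin{pmatrix}1&0\\0&0\end{pmatrix}$, $q=B\rhd\begin{pmatrix}0&0\\0&1\end{pmatrix}$; then $p',q'$ are represented by $vv^\dagger$ with $v=B\binom{w}{1}$, $v=B\binom{w'}{1}$, where $|w|^2,|w'|^2>0$. Write $w'/w=\rho e^{\ell\varphi}$ with $\rho\in\mathbb R^\times$, $\varphi\in\mathbb R$. For $\Lambda=-1,0$ the pair $(\rho,\varphi)$ is unique and the generalized dihedral angle at the edge is $|\varphi|$, called interior if $\rho>0$ and exterior if $\rho<0$ (a Lorentzian angle between the faces for $\Lambda=-1$, the length of the translation along the degenerate direction relating the faces for $\Lambda=0$). For $\Lambda=1$ the interior angle is $|\varphi|$ for the representation with $\rho>0$, $|\varphi|<\pi$ (the usual dihedral angle), and the exterior angle is $\pi$ minus the interior one. By convention one takes the interior angle at two pairs of opposite edges and the exterior angle at the remaining pair, the latter being the largest of the three numbers used. *)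

(* Defs.v *)
From HB Require Import structures.
From mathcomp Require Import all_boot all_order all_algebra.
From mathcomp Require Import all_classical all_reals all_analysis.
From mathcomp Require Import ring.

Set Implicit Arguments.
Unset Strict Implicit.
Unset Printing Implicit Defensive.

Import Order.TTheory GRing.Theory Num.Theory.
Import numFieldNormedType.Exports.

Local Open Scope classical_set_scope.
Local Open Scope ring_scope.

(* The three values -1, 0, 1 of Lambda. *)
Inductive Lambda := LamN1 | Lam0 | Lam1.

Definition lamval (R : realType) (L : Lambda) : R :=
  match L with LamN1 => -1 | Lam0 => 0 | Lam1 => 1 end.

(* C_Lambda = R[l]/(l^2 + Lambda): MkCL x y stands for x + l y. *)
Record CL (R : realType) (L : Lambda) := MkCL { cre : R; cim : R }.
Arguments MkCL {R L} _ _.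

Section CLambdaRing.
Variables (R : realType) (L : Lambda).
Local Notation C := (CL R L).
Implicit Types x y z : C.

Definition CL_pair z : R * R := (cre z, cim z).
Definition pair_CL (p : R * R) : C := MkCL p.1 p.2.
Lemma CL_pairK : cancel CL_pair pair_CL. Proof. by case. Qed.

HB.instance Definition _ := Choice.copy C (can_type CL_pairK).

Definition addCL x y : C := MkCL (cre x + cre y) (cim x + cim y).
Definition oppCL x : C := MkCL (- cre x) (- cim x).
Definition mulCL x y : C :=
  MkCL (cre x * cre y - lamval R L * (cim x * cim y))
       (cre x * cim y + cim x * cre y).

Fact addCLA : associative addCL.
Proof. by move=> [a b] [c d] [e f]; congr MkCL; rewrite /= addrA. Qed.
Fact addCLC : commutative addCL.
Proof. by move=> [a b] [c d]; congr MkCL; rewrite /= addrC. Qed.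
Fact add0CL : left_id (MkCL 0 0) addCL.
Proof. by move=> [a b]; congr MkCL; rewrite /= add0r. Qed.
Fact addNCL : left_inverse (MkCL 0 0) oppCL addCL.
Proof. by move=> [a b]; congr MkCL; rewrite /= addNr. Qed.

HB.instance Definition _ :=
  GRing.isZmodule.Build C addCLA addCLC add0CL addNCL.

Fact mulCLA : associative mulCL.
Proof. by move=> [a b] [c d] [e f]; congr MkCL => /=; ring. Qed.
Fact mulCLC : commutative mulCL.
Proof. by move=> [a b] [c d]; congr MkCL => /=; ring. Qed.
Fact mul1CL : left_id (MkCL 1 0) mulCL.
Proof. by move=> [a b]; congr MkCL => /=; ring. Qed.
Fact mulCLDl : left_distributive mulCL +%R.
Proof. by move=> [a b] [c d] [e f]; congr MkCL => /=; ring. Qed.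
Fact oneCL_neq0 : MkCL 1 0 != 0 :> C.
Proof. by apply/eqP => -[] /eqP; rewrite oner_eq0. Qed.

HB.instance Definition _ := GRing.Zmodule_isComNzRing.Build C
  mulCLA mulCLC mul1CL mulCLDl oneCL_neq0.

Definition CLconj z : C := MkCL (cre z) (- cim z).

(* |z|^2 = z (CLconj z), which is real (see CLnormsqE). *)
Definition CLnormsq z : R := cre (z * CLconj z).

Definition CLreal (r : R) : C := MkCL r 0.

Lemma CLnormsqE z : CLreal (CLnormsq z) = z * CLconj z.
Proof. by case: z => a b; congr MkCL => /=; ring. Qed.

Lemma CLnormsqM x y : CLnormsq (x * y) = CLnormsq x * CLnormsq y.
Proof. by case: x y => [a b] [c d]; rewrite /CLnormsq /=; ring. Qed.

Lemma CL_ell_sq : MkCL 0 1 ^+ 2 = CLreal (- lamval R L) :> C.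
Proof. by congr MkCL => /=; ring. Qed.

(* For Lambda = -1 and Lambda = 0, C_Lambda has zero divisors; its units are
   the elements with |z|^2 <> 0. *)
Definition CLunit : {pred C} := [pred z | CLnormsq z != 0].
Definition CLinv z : C :=
  if CLnormsq z != 0 then CLconj z * CLreal (CLnormsq z)^-1 else z.

Fact CLmulVx : {in CLunit, left_inverse 1 CLinv *%R}.
Proof.
move=> z; rewrite inE => nz; rewrite /CLinv nz mulrAC [CLconj z * z]mulrC.
rewrite -CLnormsqE; congr MkCL => /=; last by ring.
by rewrite mulr0 mulr0 subr0 divff.
Qed.

Fact CLunitPl x y : y * x = 1 -> CLunit x.
Proof.
move=> yx1; rewrite /CLunit /=; apply/eqP => nx0.
have : CLnormsq (y * x) = 0 by rewrite CLnormsqM nx0 mulr0.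
rewrite yx1 /CLnormsq /= => /eqP.
by rewrite oppr0 !mulr0 subr0 mulr1 oner_eq0.
Qed.

Fact CLinv_out : {in [predC CLunit], CLinv =1 id}.
Proof. by move=> z; rewrite !inE negbK /CLinv => /eqP ->; rewrite eqxx. Qed.

HB.instance Definition _ := GRing.ComNzRing_hasMulInverse.Build C
  CLmulVx CLunitPl CLinv_out.

End CLambdaRing.

Definition sL (R : realType) (L : Lambda) (t : R) : R :=
  match L with
  | LamN1 => (expR t - expR (- t)) / 2
  | Lam0 => t
  | Lam1 => sin t
  end.

Definition cL (R : realType) (L : Lambda) (t : R) : R :=
  match L with
  | LamN1 => (expR t + expR (- t)) / 2
  | Lam0 => 1
  | Lam1 => cos t
  end.

(* e^(l t) *)
Definition expl (R : realType) (L : Lambda) (t : R) : CL R L :=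
  MkCL (cL L t) (sL L t).

Section Space.
Variables (R : realType) (L : Lambda).
Local Notation C := (CL R L).
Local Notation M2 := ('M[C]_2).

Definition mx2 (a b c d : C) : M2 :=
  \matrix_(i < 2, j < 2)
    if i == 0 then (if j == 0 then a else b) else (if j == 0 then c else d).

Definition cv2 (a b : C) : 'cV[C]_2 := \col_(i < 2) if i == 0 then a else b.

Definition dagger m n (y : 'M[C]_(m, n)) : 'M[C]_(n, m) :=
  map_mx (@CLconj R L) y^T.

Definition hermitian (y : M2) : Prop := dagger y = y.

Definition rscale (r : R) (y : M2) : M2 := CLreal L r *: y.

(* Hermitian matrices have real determinants. *)
Definition rdet (y : M2) : R := cre (\det y).

Definition rank1 (v : 'cV[C]_2) : M2 := v *m dagger v.

(* A point of the projectivization of {y = y^dagger} is the set of all its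
   representatives, i.e. a class modulo R^x. *)
Definition ppoint : Type := set M2.

Definition pclass (y : M2) : ppoint :=
  [set rscale r y | r in [set r : R | r != 0]].

Definition Yspace : set ppoint :=
  [set pclass y | y in [set y : M2 | hermitian y /\ 0 < rdet y]].

Definition bdY : set ppoint :=
  [set pclass (rank1 v) | v in [set v : 'cV[C]_2 | rank1 v != 0]].

(* B represents an element of PGL^+(2, C_Lambda).  All the notions below only
   depend on B modulo C_Lambda^x, since (u B) y (u B)^dagger = |u|^2 B y B^dagger. *)
Definition PGLp (B : M2) : Prop := 0 < CLnormsq (\det B).

Definition act (B : M2) (p : ppoint) : ppoint :=
  [set B *m y *m dagger B | y in p].

Definition conj_act (p : ppoint) : ppoint := [set map_mx (@CLconj R L) y | y in p].

Inductive isometry : (ppoint -> ppoint) -> Prop :=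
| isometry_act B of PGLp B : isometry (act B)
| isometry_conj : isometry conj_act
| isometry_id : isometry id
| isometry_comp f g of isometry f & isometry g : isometry (f \o g)
| isometry_inv f g of isometry f & cancel f g & cancel g f : isometry g.

Definition isometric (I J : set ppoint) : Prop :=
  exists f, isometry f /\ f @` I = J.

(* The exponential series, with entrywise limits of real and imaginary parts. *)
Definition expmx_partial (Y : M2) (n : nat) : M2 :=
  \sum_(k < n) rscale (k`!%:R^-1) (Y ^+ k).

Definition expmx (Y : M2) : M2 :=
  \matrix_(i, j) MkCL (lim ((fun n => cre (expmx_partial Y n i j)) @ \oo))
                      (lim ((fun n => cim (expmx_partial Y n i j)) @ \oo)).

Definition geodesic_data (B Y : M2) : Prop :=
  [/\ PGLp B, hermitian Y, Y != 0 & \tr Y = 0].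

Definition geodesic (B Y : M2) (t : R) : ppoint :=
  act B (pclass (expmx (rscale t Y))).

Definition spacelike_direction (Y : M2) : Prop := 0 < - rdet Y.

Definition lincomb n (y : 'I_n -> M2) (b : 'I_n -> R) : M2 :=
  \sum_(i < n) rscale (b i) (y i).

Definition lin_indep n (y : 'I_n -> M2) : Prop :=
  forall b : 'I_n -> R, lincomb y b = 0 -> forall i, b i = 0.

Definition geodesic_plane (P : set ppoint) : Prop :=
  exists w : 'I_3 -> M2,
    [/\ forall i, hermitian (w i), lin_indep w &
        P = Yspace `&` [set pclass (lincomb w b) | b in [set: 'I_3 -> R]]].

Definition spacelike_plane (P : set ppoint) : Prop :=
  geodesic_plane P /\
  forall B Y, geodesic_data B Y -> (forall t, P (geodesic B Y t)) ->
    spacelike_direction Y.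

Definition cone_coef (b : 'I_4 -> R) : Prop :=
  (forall i, 0 <= b i) /\ \sum_(i < 4) b i != 0.

Definition simplex (y : 'I_4 -> M2) : set ppoint :=
  Yspace `&` [set pclass (lincomb y b) | b in cone_coef].

(* The face opposite to the k-th vertex. *)
Definition face (y : 'I_4 -> M2) (k : 'I_4) : set ppoint :=
  Yspace `&` [set pclass (lincomb y b) | b in [set b | cone_coef b /\ b k = 0]].

Definition on_vertex_ray (y : 'I_4 -> M2) (x : M2) : Prop :=
  exists k r, 0 < r /\ x = rscale r (y k).

(* I is an ideal tetrahedron with vertices p 0, ..., p 3. *)
Definition ideal_tetrahedron (I : set ppoint) (p : 'I_4 -> ppoint) : Prop :=
  exists y : 'I_4 -> M2,
    [/\ forall i, bdY (p i) /\ p i = pclass (y i),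
        lin_indep y,
        forall b, cone_coef b -> ~ on_vertex_ray y (lincomb y b) ->
          Yspace (pclass (lincomb y b)),
        I = simplex y &
        forall k, exists P, spacelike_plane P /\ face y k `<=` P].

(* w, w' are the coordinates of the vertices p', q' in a normalization
   sending the endpoints p, q of an edge to infinity and 0. *)
Definition edge_coords (p q p' q' : ppoint) (w w' : C) : Prop :=
  exists B : M2,
    [/\ PGLp B,
        p = act B (pclass (mx2 1 0 0 0)),
        q = act B (pclass (mx2 0 0 0 1)),
        p' = pclass (rank1 (B *m cv2 w 1)) /\
        q' = pclass (rank1 (B *m cv2 w' 1)) &
        0 < CLnormsq w /\ 0 < CLnormsq w'].

(* (rho, phi) are polar coordinates of w'/w at the edge with endpoints p, q,
   where p', q' are the other two vertices. *)
Definition edge_polar (p q p' q' : ppoint) (rho phi : R) : Prop :=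
  exists w w', edge_coords p q p' q' w w' /\
    w' / w = CLreal L rho * expl L phi.

Definition interior_angle (p q p' q' : ppoint) (a : R) : Prop :=
  exists rho phi, [/\ edge_polar p q p' q' rho phi, 0 < rho,
    (L = Lam1 -> `|phi| < pi) & a = `|phi|].

Definition exterior_angle (p q p' q' : ppoint) (a : R) : Prop :=
  match L with
  | Lam1 => exists2 a', interior_angle p q p' q' a' & a = pi - a'
  | _ => exists rho phi,
      [/\ edge_polar p q p' q' rho phi, rho < 0 & a = `|phi|]
  end.

Definition vertices4 (p1 p2 p3 p4 : ppoint) : 'I_4 -> ppoint :=
  tnth [tuple p1; p2; p3; p4].

(* The generalized dihedral angles of I, in pairs belonging to opposite edges:
   interior angles a, a' and b, b', exterior angles c, c'. *)
Definition gen_dihedral_angles (I : set ppoint) (a a' b b' c c' : R) : Prop :=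
  exists p1 p2 p3 p4 : ppoint,
    [/\ ideal_tetrahedron I (vertices4 p1 p2 p3 p4),
        interior_angle p1 p3 p2 p4 a /\ interior_angle p2 p4 p1 p3 a',
        interior_angle p1 p4 p2 p3 b /\ interior_angle p2 p3 p1 p4 b',
        exterior_angle p1 p2 p3 p4 c /\ exterior_angle p3 p4 p1 p2 c' &
        forall x y, x \in [:: a; a'; b; b'] -> y \in [:: c; c'] -> x <= y].

End Space.

(* Main.v *)
(** Normalize the vertices to infinity, 0, 1 and z.  The cross ratio w'/w attached to an
edge does not depend on the normalization; at the six edges it is 1 - z, (z - 1)/z and z
(up to inversion), each on a pair of opposite edges.  Writing
1 - z = r1 e^(l f1) and (z - 1)/z = r2 e^(l f2) with r1, r2 > 0, the law of sines in the
triangle 0, 1, z gives z = - (s(a)/s(b)) e^(-+ l (a + b)) with a = |f1| and b = |f2|, so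
the two interior angles determine z up to conjugation.  Exchanging a and b amounts to
relabelling the last two vertices.  The vertex classes only determine the simplex once
the signs of their representatives are fixed; these must all agree because the edges lie
in Y_Lambda. *)
From HB Require Import structures.
Require Import Defs.
From mathcomp Require Import all_boot all_order all_algebra.
From mathcomp Require Import all_classical all_reals all_analysis.
From mathcomp Require Import fingroup perm ring lra.

Import Order.TTheory GRing.Theory Num.Theory.
Import numFieldNormedType.Exports.

Local Open Scope classical_set_scope.
Local Open Scope ring_scope.

(** * Polar coordinates in C_Lambda and the law of sines *)

Section Trigonometry.
Context {R : realType} {L : Lambda}.
Implicit Types (x y z : CL R L) (r a b t f : R).

Lemma CL_eq x y : cre x = cre y -> cim x = cim y -> x = y.
Proof. by case: x y => [? ?] [? ?] /= -> ->. Qed.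

Lemma CLnormsq_unit z : 0 < CLnormsq z -> z \is a GRing.unit.
Proof. exact: lt0r_neq0. Qed.

Lemma CLrealM r a : CLreal L (r * a) = CLreal L r * CLreal L a.
Proof. by apply: CL_eq => /=; ring. Qed.

Lemma CLconjM x y : CLconj (x * y) = CLconj x * CLconj y.
Proof. by apply: CL_eq => /=; ring. Qed.

Lemma CLconjK x : CLconj (CLconj x) = x.
Proof. by apply: CL_eq => /=; ring. Qed.

Lemma CLnormsq_real r : CLnormsq (CLreal L r) = r ^+ 2.
Proof. by rewrite /CLnormsq /=; ring. Qed.

Lemma CLnormsq_expl t : CLnormsq (expl L t) = 1.
Proof.
rewrite /CLnormsq /expl; case: L => /=.
- have := expRxMexpNx_1 t; move: (expR t) (expR (- t)) => u v uv.
  by rewrite -[RHS]uv; field.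
- by ring.
- by rewrite -[RHS](cos2Dsin2 t); ring.
Qed.

Lemma explD s t : expl L (s + t) = expl L s * expl L t.
Proof.
by apply: CL_eq; rewrite /expl /=; case: L => /=;
  rewrite ?opprD ?expRD ?cosD ?sinD; field.
Qed.

Lemma expl0 : expl L 0 = 1 :> CL R L.
Proof.
by apply: CL_eq; rewrite /expl /=; case: L => //=;
  rewrite ?oppr0 ?expR0 ?cos0 ?sin0 //; field.
Qed.

Lemma explNK t : expl L t * expl L (- t) = 1.
Proof. by rewrite -explD subrr expl0. Qed.

Lemma sLN t : sL L (- t) = - sL L t.
Proof. by case: L => //=; rewrite ?sinN // opprK -mulNr opprB. Qed.

Lemma CLconj_expl t : CLconj (expl L t) = expl L (- t).
Proof.
by apply: CL_eq => /=; rewrite ?sLN //; case: L => //=; rewrite ?cosN // opprK addrC.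
Qed.

Lemma sL_gt0 t : 0 < t -> (L = Lam1 -> t < pi) -> 0 < sL L t.
Proof.
move=> t0; case: L => //= tpi; last by rewrite sin_gt0_pi // t0 tpi.
by rewrite divr_gt0 // subr_gt0 ltr_expR gtrN.
Qed.

(** [sL] is odd and positive on the positive half of the admissible range, so a nonpositive [t]
    would give a nonpositive value. *)
Lemma gt0_of_sL t : (L = Lam1 -> `|t| < pi) -> 0 < sL L t -> 0 < t.
Proof.
move=> tpi; rewrite ltNge => /negP h; rewrite ltNge; apply/negP => t0; apply: h.
move: t0; rewrite le_eqVlt => /orP[/eqP ->|t0].
  by have /eqP := sLN 0; rewrite oppr0 -addr_eq0 -mulr2n mulrn_eq0 => /eqP ->.
rewrite -oppr_ge0 -sLN ltW // sL_gt0 ?oppr_gt0 // => /tpi.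
by rewrite ltr0_norm.
Qed.

(** The norm recovers [r]. In the hyperbolic case [cosh t + sinh t = e^t] then recovers [t], in the
    degenerate case the imaginary part does; in the circular case the cosine is injective on
    [0, pi], whence the absolute values. *)
Lemma polar_angle_unique r r' t t' : 0 < r -> 0 < r' ->
  (L = Lam1 -> `|t| < pi) -> (L = Lam1 -> `|t'| < pi) ->
  CLreal L r * expl L t = CLreal L r' * expl L t' -> `|t| = `|t'|.
Proof.
move=> r0 r'0 tpi t'pi E.
have rr' : r = r'.
  have := congr1 (@CLnormsq R L) E.
  rewrite !CLnormsqM !CLnormsq_real !CLnormsq_expl !mulr1 => /eqP.
  by rewrite eqrXn2 ?ltW // => /eqP.
have {}E : expl L t = expl L t'.
  have := congr1 (fun z => CLreal L r^-1 * z) E.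
  rewrite !mulrA -!CLrealM -rr' mulVf ?gt_eqF //.
  by have -> : CLreal L 1 = 1 by []; rewrite !mul1r.
move: (congr1 (@cre R L) E) (congr1 (@cim R L) E) tpi t'pi => /=.
case: L => /= [c s _ _|_ -> //|c s tpi t'pi].
  suff -> : t = t' by [].
  by apply: expR_inj; lra.
apply: cos_inj; rewrite ?cos_norm // in_itv /= normr_ge0 /= ltW //.
- exact: tpi.
- exact: t'pi.
Qed.

(** In the Euclidean picture ([Lambda = 1]) this is the third vertex z of a triangle 0, 1, z with
    angle [a] at 1 and [b] at z; the minus sign turns the phase [-(a + b)] into the angle
    [pi - (a + b)] at 0. *)
Definition apex a b : CL R L := CLreal L (- (sL L a / sL L b)) * expl L (- (a + b)).

Lemma sLD s t : sL L (s + t) = cL L s * sL L t + sL L s * cL L t.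
Proof. by have /= -> := congr1 (@cim R L) (explD s t). Qed.

Lemma cLN t : cL L (- t) = cL L t.
Proof. by have /= -> := congr1 (@cre R L) (CLconj_expl t). Qed.

(** After clearing [sL L b], the real part is the addition formula for [b = (a + b) - a]; the
    imaginary parts agree at once. *)
Lemma sub1_apex a b : sL L b != 0 ->
  1 - apex a b = CLreal L (sL L (a + b) / sL L b) * expl L (- a).
Proof.
move=> b0; have E : sL L b = sL L (a + b) * cL L a - cL L (a + b) * sL L a.
  by have := sLD (- a) (a + b); rewrite addKr cLN sLN => ->; ring.
apply: CL_eq => /=; rewrite ?cLN ?sLN; last by field.
by apply: (mulfI b0); rewrite [LHS](_ : _ = sL L b + sL L a * cL L (a + b));
  [rewrite {1}E; field | field].
Qed.

Lemma apex_sub1 a b : sL L a != 0 -> sL L b != 0 ->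
  apex a b - 1 = apex a b * (CLreal L (sL L (a + b) / sL L a) * expl L b).
Proof.
move=> a0 b0; rewrite -opprB sub1_apex //.
have -> : expl L (- a) = expl L (- (a + b)) * expl L b.
  by rewrite -explD opprD addrNK.
rewrite /apex mulrACA -CLrealM -mulNr; congr (_ * _).
by apply: CL_eq => /=; field; rewrite ?a0.
Qed.

Lemma CLconj_apex a b :
  CLconj (apex a b) = CLreal L (- (sL L a / sL L b)) * expl L (a + b).
Proof.
rewrite /apex CLconjM CLconj_expl opprK; congr (_ * _).
by apply: CL_eq => //=; rewrite oppr0.
Qed.

(* Law of sines for the triangle 0, 1, z, whose angles at 1 and z are |f1| and
   |f2|: both sides of each equation are read off 1 - z = r1 e^(l f1) and
   -z = (r1/r2) e^(l (f1 - f2)). *)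
Lemma apex_of_angles z r1 r2 f1 f2 : cim z != 0 -> 0 < r1 -> 0 < r2 ->
  (L = Lam1 -> `|f1| < pi) -> (L = Lam1 -> `|f2| < pi) ->
  1 - z = CLreal L r1 * expl L f1 ->
  z - 1 = z * (CLreal L r2 * expl L f2) ->
  z = apex `|f1| `|f2| \/ z = CLconj (apex `|f1| `|f2|).
Proof.
move=> z0 r1_0 r2_0 f1pi f2pi E1 E2; pose r := r1 / r2.
have r0 : 0 < r by rewrite divr_gt0.
(* Multiplying the equation for [z - 1] by the inverse of [r2 e^(l f2)] isolates [z], while
   [z - 1 = - r1 e^(l f1)]. *)
have Ez : z = CLreal L (- r) * expl L (f1 - f2).
  rewrite explD; have <- : CLreal L r2^-1 * expl L (- f2) * (z - 1)
      = CLreal L (- r) * (expl L f1 * expl L (- f2)).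
    rewrite -opprB E1; apply: CL_eq => /=; rewrite /r; ring.
  rewrite E2; transitivity (z * CLreal L (r2^-1 * r2) * (expl L f2 * expl L (- f2))).
    rewrite explNK mulVf ?gt_eqF //; apply: CL_eq => /=; ring.
  by rewrite CLrealM; ring.
have Ere : 1 + r * cL L (f1 - f2) = r1 * cL L f1.
  by have /= := congr1 (@cre R L) E1; rewrite Ez /=; lra.
have Eim : r * sL L (f1 - f2) = r1 * sL L f1.
  by have /= := congr1 (@cim R L) E1; rewrite Ez /=; lra.
(* Expand the sine of [- f1 + (f1 - f2)] and insert [Eim] and [Ere]: the terms
   [r1 * cL L f1 * sL L f1] cancel. *)
have sine : r * sL L (- f2) = sL L f1.
  have -> : - f2 = - f1 + (f1 - f2) by ring.
  rewrite sLD cLN sLN; have := congr1 (fun x : R => x * sL L f1) Ere.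
  have := congr1 (fun x : R => x * cL L f1) Eim; rewrite /=; lra.
have s1 : sL L f1 != 0.
  apply: contra_neq z0 => s0; rewrite Ez /=.
  by rewrite mulNr Eim s0 mulr0 mul0r addr0 oppr0.
have {Ez} Ez : z = CLreal L (- (sL L f1 / sL L (- f2))) * expl L (f1 - f2).
  rewrite Ez -sine mulfK //; apply: contra_neq s1 => s2.
  by rewrite -sine s2 mulr0.
(* By [sine] and [r > 0], the angles [f1] and [f2] have opposite signs; which of them is positive
   decides between the apex and its conjugate. *)
case: (ltgtP (sL L f1) 0) s1 => // s1 _.
- have f1_0 : f1 < 0.
    by rewrite -oppr_gt0 gt0_of_sL ?normrN // sLN oppr_gt0.
  have f2_0 : 0 < f2.
    by rewrite gt0_of_sL //; rewrite sLN in sine; nra.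
  left; rewrite Ez /apex (ltr0_norm f1_0) (gtr0_norm f2_0) !sLN.
  by rewrite opprD opprK invrN mulrN mulNr.
- have f1_0 : 0 < f1 by rewrite gt0_of_sL.
  have f2_0 : f2 < 0.
    by rewrite -oppr_gt0 gt0_of_sL ?normrN //; nra.
  by right; rewrite Ez CLconj_apex (gtr0_norm f1_0) (ltr0_norm f2_0).
Qed.

End Trigonometry.

(** * Hermitian matrices up to scaling *)

Section Projective.
Context {R : realType} {L : Lambda}.
Local Notation C := (CL R L).
Local Notation M2 := ('M[C]_2).
Implicit Types (B x y : M2) (u v : 'cV[C]_2) (r s : R).

Fact CLconj_is_zmod_morphism : zmod_morphism (@CLconj R L).
Proof. by move=> x y; apply: CL_eq => //=; ring. Qed.
HB.instance Definition _ :=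
  GRing.isZmodMorphism.Build C C (@CLconj R L) CLconj_is_zmod_morphism.

Fact CLconj_is_monoid_morphism : monoid_morphism (@CLconj R L).
Proof. by split=> [|x y]; [apply: CL_eq => //=; rewrite oppr0|exact: CLconjM]. Qed.
HB.instance Definition _ :=
  GRing.isMonoidMorphism.Build C C (@CLconj R L) CLconj_is_monoid_morphism.

Lemma daggerM m n p (A : 'M[C]_(m, n)) (B : 'M[C]_(n, p)) :
  dagger (A *m B) = dagger B *m dagger A.
Proof. by rewrite /dagger trmx_mul map_mxM. Qed.

Lemma rscaleA r s y : rscale r (rscale s y) = rscale (r * s) y.
Proof. by rewrite /rscale scalerA -CLrealM. Qed.

Lemma rscale1 y : rscale 1 y = y.
Proof. exact: scale1r. Qed.

Lemma mulmx_rscale B r y : B *m rscale r y *m dagger B = rscale r (B *m y *m dagger B).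
Proof. by rewrite /rscale -scalemxAr -scalemxAl. Qed.

Lemma map_conj_rscale r y :
  map_mx (@CLconj R L) (rscale r y) = rscale r (map_mx (@CLconj R L) y).
Proof.
rewrite /rscale map_mxZ; congr (_ *: _).
by apply: CL_eq => //=; rewrite oppr0.
Qed.

Lemma det2E y : \det y = y 0 0 * y 1 1 - y 0 1 * y 1 0.
Proof.
rewrite (expand_det_row _ 0) !big_ord_recl big_ord0 /cofactor !det_mx11 !mxE /=.
rewrite expr0 expr1 addr0 mul1r mulN1r mulrN.
by congr (y _ _ * y _ _ - y _ _ * y _ _); exact: val_inj.
Qed.

Definition det2 u v : C := u 0 0 * v 1 0 - u 1 0 * v 0 0.

Lemma mulmx2E B u i : (B *m u) i 0 = B i 0 * u 0 0 + B i 1 * u 1 0.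
Proof.
by rewrite mxE !big_ord_recl big_ord0 addr0; congr (B _ _ * u _ _ + B _ _ * u _ _);
  exact: val_inj.
Qed.

Lemma rank1E v i j : rank1 v i j = v i 0 * CLconj (v j 0).
Proof. by rewrite mxE big_ord1 !mxE. Qed.

Lemma det2_mul B u v : det2 (B *m u) (B *m v) = \det B * det2 u v.
Proof. by rewrite /det2 !mulmx2E det2E; ring. Qed.

Lemma det2Z a b u v : det2 (a *: u) (b *: v) = a * b * det2 u v.
Proof. by rewrite /det2 !mxE; ring. Qed.

Lemma rank1_mul B v : rank1 (B *m v) = B *m rank1 v *m dagger B.
Proof. by rewrite /rank1 daggerM !mulmxA. Qed.

Lemma rank1Z a v : rank1 (a *: v) = rscale (CLnormsq a) (rank1 v).
Proof.
by apply/matrixP => i j; rewrite [RHS]mxE !rank1E !mxE CLconjM CLnormsqE; ring.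
Qed.

(** Rank one matrices are null for the quadratic form det, so only the polar term survives. It
    decides whether the points of an edge lie in the space. *)
Lemma rdet_add_rank1 r s u v :
  rdet (rscale r (rank1 u) + rscale s (rank1 v)) = r * s * CLnormsq (det2 u v).
Proof.
have -> : r * s * CLnormsq (det2 u v)
    = cre (CLreal L (r * s) * (det2 u v * CLconj (det2 u v))).
  by rewrite -CLnormsqE /=; ring.
have E i j : (rscale r (rank1 u) + rscale s (rank1 v)) i j =
    CLreal L r * (u i 0 * CLconj (u j 0)) + CLreal L s * (v i 0 * CLconj (v j 0)).
  by rewrite mxE [X in X + _]mxE [X in _ + X]mxE 2!rank1E.
by congr cre; rewrite det2E 4!E CLrealM /det2 rmorphB !rmorphM /=; ring.
Qed.

Lemma rdet_rscale r y : rdet (rscale r y) = r ^+ 2 * rdet y.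
Proof.
rewrite /rdet detZ; have -> : CLreal L r ^+ 2 = CLreal L (r ^+ 2) by rewrite !expr2 CLrealM.
by rewrite /=; ring.
Qed.

Lemma rdet_mul B y : rdet (B *m y *m dagger B) = CLnormsq (\det B) * rdet y.
Proof.
rewrite /rdet !det_mulmx /dagger det_map_mx det_tr mulrAC -CLnormsqE /=.
by ring.
Qed.

Lemma pclass_eqP x y : pclass x = pclass y <-> exists2 r, r != 0 & x = rscale r y.
Proof.
split=> [E|[r r0 ->]].
  have : pclass y x by rewrite -E; exists 1; rewrite /= ?oner_eq0 // rscale1.
  by case=> r r0 <-; exists r.
apply/seteqP; split=> _ [s s0 <-] /=.
  by exists (s * r); rewrite /= ?mulf_neq0 // rscaleA.
by exists (s / r); rewrite /= ?mulf_neq0 ?invr_eq0 // rscaleA divfK.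
Qed.

Lemma act_pclass B y : act B (pclass y) = pclass (B *m y *m dagger B).
Proof.
apply/seteqP; split=> [_ [_ [s s0 <-] <-]|_ [s s0 <-]] /=.
  by exists s; rewrite // mulmx_rscale.
by exists (rscale s y); rewrite ?mulmx_rscale //; exists s.
Qed.

Lemma conj_pclass y : conj_act (pclass y) = pclass (map_mx (@CLconj R L) y).
Proof.
apply/seteqP; split=> [_ [_ [s s0 <-] <-]|_ [s s0 <-]] /=.
  by exists s; rewrite // map_conj_rscale.
by exists (rscale s y); rewrite ?map_conj_rscale //; exists s.
Qed.

Lemma rdet_gt0_of_Yspace y : Yspace (pclass y) -> 0 < rdet y.
Proof.
case=> x [_ x0] /pclass_eqP[r r0 E]; move: x0; rewrite E rdet_rscale pmulr_rgt0 //.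
by rewrite lt_neqAle sqr_ge0 eq_sym sqrf_eq0 r0.
Qed.

Lemma PGLp_unit B : PGLp B -> B \in unitmx.
Proof. by rewrite unitmxE; exact: CLnormsq_unit. Qed.

Lemma CLnormsq_inv_gt0 (a : C) : 0 < CLnormsq a -> 0 < CLnormsq a^-1.
Proof.
move=> a0; have : CLnormsq (a * a^-1) = 1.
  by rewrite divrr ?CLnormsq_unit // /CLnormsq /=; ring.
by rewrite CLnormsqM -(pmulr_rgt0 _ a0) => ->.
Qed.

Lemma PGLp_inv B : PGLp B -> PGLp (invmx B).
Proof. by rewrite /PGLp det_inv; exact: CLnormsq_inv_gt0. Qed.

Lemma act_comp A B : act A \o act B = act (A *m B).
Proof.
apply/funext => p; apply/seteqP; split=> [_ [_ [y py <-] <-]|_ [y py <-]].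
  by exists y; rewrite // daggerM !mulmxA.
by exists (B *m y *m dagger B); [exists y | rewrite daggerM !mulmxA].
Qed.

Lemma act1 : act 1%:M = id :> (ppoint R L -> ppoint R L).
Proof.
have E y : 1%:M *m y *m dagger 1%:M = y.
  by rewrite /dagger trmx1 map_mx1 mulmx1 mul1mx.
apply/funext => p; apply/seteqP; split=> [_ [y py <-]|y py]; first by rewrite E.
by exists y.
Qed.

Lemma conj_actK : @conj_act R L \o @conj_act R L = id.
Proof.
have E y : map_mx (@CLconj R L) (map_mx (@CLconj R L) y) = y.
  by apply/matrixP => i j; rewrite !mxE CLconjK.
apply/funext => p; apply/seteqP; split=> [_ [_ [y py <-] <-]|y py]; first by rewrite E.
by exists (map_mx (@CLconj R L) y); [exists y | exact: E].
Qed.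

Lemma Yspace_act B p : PGLp B -> Yspace p -> Yspace (act B p).
Proof.
move=> B0 [y [hy y0] <-]; rewrite act_pclass; exists (B *m y *m dagger B) => //; split.
  rewrite /Defs.hermitian !daggerM hy mulmxA; congr (_ *m _ *m _).
  by apply/matrixP => i j; rewrite !mxE CLconjK.
by rewrite rdet_mul // mulr_gt0.
Qed.

Lemma Yspace_conj p : Yspace p -> Yspace (@conj_act R L p).
Proof.
move=> [y [hy y0] <-]; rewrite conj_pclass; exists (map_mx (@CLconj R L) y) => //; split.
  by rewrite /Defs.hermitian -{2}hy; apply/matrixP => i j; rewrite !mxE.
by rewrite /rdet det_map_mx.
Qed.

Lemma isometric_trans (I J K : set (ppoint R L)) :
  isometric I J -> isometric J K -> isometric I K.
Proof.
move=> [f [isof <-]] [g [isog <-]]; exists (g \o f); split; first exact: isometry_comp.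
by rewrite image_comp.
Qed.

Lemma isometric_act B (I : set (ppoint R L)) : PGLp B ->
  isometric I (act B @` I) /\ isometric (act B @` I) I.
Proof.
move=> B0; split; [exists (act B) | exists (act (invmx B))]; split=> //.
- exact: isometry_act.
- by apply: isometry_act; exact: PGLp_inv.
- by rewrite image_comp act_comp mulVmx ?PGLp_unit // act1 image_id.
Qed.

Lemma isometric_conj (I : set (ppoint R L)) :
  isometric I (@conj_act R L @` I) /\ isometric (@conj_act R L @` I) I.
Proof.
split; exists (@conj_act R L); split=> //; try exact: isometry_conj.
by rewrite image_comp conj_actK image_id.
Qed.

End Projective.

(** * Simplices *)

Section Simplices.
Context {R : realType} {L : Lambda}.
Local Notation C := (CL R L).
Local Notation M2 := ('M[C]_2).
Implicit Types (B : M2) (x y : 'I_4 -> M2) (b r : 'I_4 -> R).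

Lemma lincomb_rscale y r b :
  lincomb (fun i => rscale (r i) (y i)) b = lincomb y (fun i => b i * r i).
Proof. by apply: eq_bigr => i _; rewrite rscaleA. Qed.

Lemma rscale_lincomb c y b : rscale c (lincomb y b) = lincomb y (fun i => c * b i).
Proof. by rewrite /rscale scaler_sumr; apply: eq_bigr => i _; rewrite -rscaleA. Qed.

Lemma lincombD y b b' : lincomb y (fun i => b i + b' i) = lincomb y b + lincomb y b'.
Proof.
rewrite -big_split; apply: eq_bigr => i _; rewrite /rscale /= -scalerDl; congr (_ *: _).
by apply: CL_eq => //=; rewrite addr0.
Qed.

Lemma lincomb_delta y k : lincomb y (fun i => (i == k)%:R) = y k.
Proof.
rewrite /lincomb (bigD1 k) //= eqxx rscale1 big1 ?addr0 // => i /negbTE ->.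
by rewrite /rscale (_ : CLreal L 0%:R = 0) // scale0r.
Qed.

Lemma lincomb_inj y b b' : lin_indep y -> lincomb y b = lincomb y b' -> b =1 b'.
Proof.
move=> hy E i; apply/eqP; rewrite -subr_eq0 -mulN1r; apply/eqP.
apply: (hy (fun i => b i + -1 * b' i)).
rewrite lincombD -rscale_lincomb E -{1}[lincomb y b']rscale1 /rscale -scalerDl.
rewrite (_ : CLreal L 1 + CLreal L (-1) = 0) ?scale0r //.
by apply: CL_eq => /=; rewrite ?subrr ?addr0.
Qed.

Lemma lincomb_perm y b (s : {perm 'I_4}) : lincomb (y \o s) (b \o s) = lincomb y b.
Proof. by rewrite [RHS](reindex_inj (@perm_inj _ s)). Qed.

Lemma lincomb_mul B y b :
  lincomb (fun i => B *m y i *m dagger B) b = B *m lincomb y b *m dagger B.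
Proof.
by rewrite mulmx_sumr mulmx_suml; apply: eq_bigr => i _; rewrite mulmx_rscale.
Qed.

Lemma lincomb_conj y b :
  lincomb (fun i => map_mx (@CLconj R L) (y i)) b = map_mx (@CLconj R L) (lincomb y b).
Proof.
by rewrite /lincomb raddf_sum; apply: eq_bigr => i _; rewrite /= map_conj_rscale.
Qed.

Lemma cone_coefM b r : (forall i, 0 < r i) -> cone_coef b -> cone_coef (fun i => r i * b i).
Proof.
move=> r0 [b0 sb]; split=> [i|]; first by rewrite mulr_ge0 // ltW.
have /psumr_neq0P[//|i /= bi] : \sum_(i < 4) b i <> 0 by exact/eqP.
rewrite gt_eqF // (bigD1 i) //= ltr_wpDr ?mulr_gt0 // sumr_ge0 // => j _.
by rewrite mulr_ge0 // ltW.
Qed.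

Lemma cone_coef_perm b (s : {perm 'I_4}) : cone_coef b -> cone_coef (b \o s).
Proof.
case=> b0 sb; split=> [i|]; first exact: b0.
by move: sb; rewrite (reindex_inj (@perm_inj _ s)).
Qed.

(** [c] carries the common sign of the [r i]: multiplying a representative by [c] keeps its class
    and makes the coefficients [c * r i * b i] nonnegative. *)
Lemma simplex_rescale_sub c r y : (forall i, 0 < c * r i) ->
  simplex (fun i => rscale (r i) (y i)) `<=` simplex y.
Proof.
move=> cr _ [/[swap] -[b bcone <-] Yp]; split=> //; exists (fun i => c * r i * b i).
  exact: cone_coefM.
have c0 : c != 0 by apply: contraTneq (cr 0) => ->; rewrite mul0r ltxx.
apply/pclass_eqP; exists c => //; rewrite lincomb_rscale rscale_lincomb.
by congr lincomb; apply/funext => i; ring.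
Qed.

Lemma simplex_rescale c r y : (forall i, 0 < c * r i) ->
  simplex (fun i => rscale (r i) (y i)) = simplex y.
Proof.
move=> cr; apply/seteqP; split; first exact: simplex_rescale_sub cr.
have r0 i : r i != 0 by apply: contraTneq (cr i) => ->; rewrite mulr0 ltxx.
rewrite [X in simplex X `<=` _](_ : _ = (fun i => rscale (r i)^-1 (rscale (r i) (y i)))).
  by apply: (simplex_rescale_sub c^-1) => i; rewrite -invfM invr_gt0.
by apply/funext => i; rewrite rscaleA mulVf // rscale1.
Qed.

Lemma simplex_act_sub B y : PGLp B ->
  act B @` simplex y `<=` simplex (fun i => B *m y i *m dagger B).
Proof.
move=> B0 _ [_ [/[swap] -[b bcone <-] Yp] <-]; split; first exact: Yspace_act.
by exists b => //; rewrite lincomb_mul act_pclass.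
Qed.

Lemma simplex_act B y : PGLp B ->
  simplex (fun i => B *m y i *m dagger B) = act B @` simplex y.
Proof.
move=> B0; apply/seteqP; split; last exact: simplex_act_sub.
have BK : B *m invmx B = 1%:M by rewrite mulmxV ?PGLp_unit.
have KB : invmx B *m B = 1%:M by rewrite mulVmx ?PGLp_unit.
(* Writing the left side as its image under [B] after the inverse of [B] reduces the reverse
   inclusion to the forward one for [invmx B]. *)
rewrite -[X in X `<=` _]image_id -act1 -BK -act_comp -image_comp; apply: image_subset.
apply: subset_trans (simplex_act_sub _ _ (PGLp_inv _ B0)) _.
rewrite [X in simplex X](_ : _ = y) //; apply/funext => i.
rewrite !mulmxA KB mul1mx -mulmxA -daggerM KB /dagger trmx1 map_mx1 mulmx1.
by [].
Qed.

Lemma simplex_conj_sub y :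
  @conj_act R L @` simplex y `<=` simplex (fun i => map_mx (@CLconj R L) (y i)).
Proof.
move=> _ [_ [/[swap] -[b bcone <-] Yp] <-]; split; first exact: Yspace_conj.
by exists b => //; rewrite lincomb_conj conj_pclass.
Qed.

Lemma simplex_conj y :
  simplex (fun i => map_mx (@CLconj R L) (y i)) = @conj_act R L @` simplex y.
Proof.
apply/seteqP; split; last exact: simplex_conj_sub.
rewrite -[X in X `<=` _]image_id -conj_actK -image_comp; apply: image_subset.
apply: subset_trans (simplex_conj_sub _) _.
rewrite [X in simplex X](_ : _ = y) //; apply/funext => k.
by apply/matrixP => i j; rewrite !mxE CLconjK.
Qed.

Lemma simplex_perm_sub y (s : {perm 'I_4}) : simplex y `<=` simplex (y \o s).
Proof.
move=> _ [/[swap] -[b bcone <-] Yp]; split=> //; exists (b \o s); last by rewrite lincomb_perm.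
exact: cone_coef_perm.
Qed.

Lemma face_perm_sub y (s : {perm 'I_4}) k : face (y \o s) k `<=` face y (s k).
Proof.
move=> _ [/[swap] -[b [bcone bk] <-] Yp]; split=> //; exists (b \o (s^-1)%g).
  by split; [exact: cone_coef_perm | rewrite /= permK].
rewrite -(lincomb_perm _ _ s); congr (pclass (lincomb _ _)).
by apply/funext => i; rewrite /= permK.
Qed.

Lemma comp_permK (T : Type) (f : 'I_4 -> T) (s : {perm 'I_4}) : (f \o s) \o (s^-1)%g = f.
Proof. by apply/funext => i; rewrite /= permKV. Qed.

Lemma ideal_tetrahedron_perm (I : set (ppoint R L)) p (s : {perm 'I_4}) :
  ideal_tetrahedron I p -> ideal_tetrahedron I (p \o s).
Proof.
move=> [y [py hy Yy -> fy]].
have lincombV b : lincomb (y \o s) b = lincomb y (b \o (s^-1)%g).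
  by rewrite -[in RHS](lincomb_perm _ _ s); congr lincomb; apply/funext => i; rewrite /= permK.
exists (y \o s); split.
- by move=> i; exact: py.
- by move=> b; rewrite lincombV => /hy b0 i; have /= := b0 (s i); rewrite permK.
- move=> b bcone; rewrite lincombV => ray; apply: Yy; first exact: cone_coef_perm.
  by move=> [k [r [r0 E]]]; apply: ray; exists ((s^-1)%g k), r; rewrite /= permKV.
- apply/seteqP; split; first exact: simplex_perm_sub.
  by apply: subset_trans (simplex_perm_sub (y \o s) (s^-1)%g) _; rewrite comp_permK.
- move=> k; have [P [sP fP]] := fy (s k); exists P; split; first exact: sP.
  exact: subset_trans (face_perm_sub y s k) fP.
Qed.

(** The ordinals carry the proof [isT] so that [tnth] on a literal tuple computes. *)
Lemma ord4_ind (P : 'I_4 -> Prop) :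
  P (@Ordinal 4 0 isT) -> P (@Ordinal 4 1 isT) ->
  P (@Ordinal 4 2 isT) -> P (@Ordinal 4 3 isT) -> forall i, P i.
Proof.
move=> P0 P1 P2 P3 [[|[|[|[|//]]]] h].
- by rewrite (bool_irrelevance h isT).
- by rewrite (bool_irrelevance h isT).
- by rewrite (bool_irrelevance h isT).
- by rewrite (bool_irrelevance h isT).
Qed.

Lemma tnth4E (T : Type) (a b c d : T) (t := [tuple a; b; c; d]) :
  (tnth t (@Ordinal 4 0 isT) = a) * (tnth t (@Ordinal 4 1 isT) = b) *
  (tnth t (@Ordinal 4 2 isT) = c) * (tnth t (@Ordinal 4 3 isT) = d).
Proof. by []. Qed.

Lemma sum_ord4 (V : nmodType) (F : 'I_4 -> V) :
  \sum_i F i = F (@Ordinal 4 0 isT) + F (@Ordinal 4 1 isT) +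
               F (@Ordinal 4 2 isT) + F (@Ordinal 4 3 isT).
Proof.
rewrite !big_ord_recr big_ord0 /= add0r.
by congr (F _ + F _ + F _ + F _); exact: val_inj.
Qed.

(** This relabelling exchanges the two pairs of edges carrying interior angles and keeps the pair
    carrying the exterior one. *)
Lemma ideal_tetrahedron_swap (I : set (ppoint R L)) p1 p2 p3 p4 :
  ideal_tetrahedron I (vertices4 p1 p2 p3 p4) ->
  ideal_tetrahedron I (vertices4 p1 p2 p4 p3).
Proof.
move=> /(ideal_tetrahedron_perm _ _ (tperm (@Ordinal 4 2 isT) (@Ordinal 4 3 isT))).
congr ideal_tetrahedron; apply/funext => i; rewrite /= /vertices4 permE.
by elim/ord4_ind: i; rewrite /= !tnth4E.
Qed.

End Simplices.

(** * Cross ratios *)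

Section CrossRatios.
Context {R : realType} {L : Lambda}.
Local Notation C := (CL R L).
Local Notation M2 := ('M[C]_2).
Implicit Types (B : M2) (u v : 'cV[C]_2) (w z : C) (p : ppoint R L).

Lemma cv2E a b (i : 'I_2) : cv2 a b i 0 = (if i == 0 then a else b) :> C.
Proof. by rewrite mxE. Qed.

Lemma rank1_cv2 (a b : C) :
  rank1 (cv2 a b) = mx2 (CLreal L (CLnormsq a)) (a * CLconj b)
                        (b * CLconj a) (CLreal L (CLnormsq b)).
Proof.
apply/matrixP => i j; rewrite rank1E !cv2E mxE !CLnormsqE.
by case: ifP; case: ifP.
Qed.

Lemma rank1_e1 : rank1 (cv2 1 0) = mx2 1 0 0 0 :> M2.
Proof. by rewrite rank1_cv2; congr mx2; apply: CL_eq; rewrite /CLnormsq /=; ring. Qed.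

Lemma rank1_e2 : rank1 (cv2 0 1) = mx2 0 0 0 1 :> M2.
Proof. by rewrite rank1_cv2; congr mx2; apply: CL_eq; rewrite /CLnormsq /=; ring. Qed.

Lemma det2_cv2 (a b c d : C) : det2 (cv2 a b) (cv2 c d) = a * d - b * c.
Proof. by rewrite /det2 !cv2E. Qed.

Lemma pclass_rank1Z (a : C) v : CLnormsq a != 0 -> pclass (rank1 (a *: v)) = pclass (rank1 v).
Proof. by move=> a0; rewrite rank1Z; apply/pclass_eqP; exists (CLnormsq a). Qed.

(* The hypothesis on x says that u is unimodular; without it the zero divisors
   of C_Lambda would allow non-proportional u and v. *)
Lemma collinear_of_pclass_eq u v x : det2 u x \is a GRing.unit ->
  pclass (rank1 v) = pclass (rank1 u) -> exists a : C, v = a *: u.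
Proof.
move=> ux /pclass_eqP[r r0 E].
have Eij i j : v i 0 * CLconj (v j 0) = CLreal L r * (u i 0 * CLconj (u j 0)).
  by rewrite -!rank1E E [LHS]mxE.
(* Pairing the second factor of [Eij] with [x] gives a relation linear in [v] and [u]; once
   [det2 v x] is a unit, the factor [a] is read off from it. *)
have Em i : v i 0 * CLconj (det2 v x) = CLreal L r * (u i 0 * CLconj (det2 u x)).
  rewrite /det2 !rmorphB !rmorphM /= !mulrBr ![v i 0 * (_ * _)]mulrA !Eij; ring.
(* By [Em], [|det2 v x|^2] equals [r |det2 u x|^2], which is a unit. *)
have vx : CLconj (det2 v x) \is a GRing.unit.
  have : CLreal L r * (det2 u x * CLconj (det2 u x)) \is a GRing.unit.
    rewrite !unitrM ux rmorph_unit // !andbT.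
    by rewrite (_ : _ \is a GRing.unit = (CLnormsq (CLreal L r) != 0)) // CLnormsq_real expf_neq0.
  rewrite (_ : _ * _ = det2 v x * CLconj (det2 v x)) ?unitrM => [/andP[]//|].
  transitivity (x 1 0 * (v 0 0 * CLconj (det2 v x)) - x 0 0 * (v 1 0 * CLconj (det2 v x))).
    by rewrite !Em {1}/det2; ring.
  by rewrite {3}/det2; ring.
exists (CLreal L r * CLconj (det2 u x) / CLconj (det2 v x)).
apply/matrixP => i j; rewrite ord1 mxE.
by apply: (mulIr vx); rewrite Em mulrAC divrK //; ring.
Qed.

(** In the frame [B] each [vi] is a multiple [ai] of a standard vector, and both sides become
    [a1 a2 a3 a4 (det B)^2 w w']. The cross-multiplied form avoids dividing by possible zero
    divisors. *)
Lemma cross_ratio_unique v1 v2 v3 v4 w w' :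
  edge_coords (pclass (rank1 v1)) (pclass (rank1 v2))
              (pclass (rank1 v3)) (pclass (rank1 v4)) w w' ->
  w' * (det2 v1 v4 * det2 v3 v2) = w * (det2 v4 v2 * det2 v1 v3).
Proof.
move=> [B [B0 p1 p2 [p3 p4] _]].
have BU : \det B \is a GRing.unit by exact: CLnormsq_unit.
have unim u x : det2 u x = 1 -> det2 (B *m u) (B *m x) \is a GRing.unit.
  by move=> ux; rewrite det2_mul ux mulr1.
(* Each standard vector gets a partner of determinant 1, the witness of unimodularity for
   [collinear_of_pclass_eq]. *)
have e12 : det2 (cv2 1 0) (cv2 0 1 : 'cV[C]_2) = 1 by rewrite det2_cv2; ring.
have e21 : det2 (cv2 0 1) (cv2 (-1) 0 : 'cV[C]_2) = 1 by rewrite det2_cv2; ring.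
have ew a : det2 (cv2 a 1) (cv2 (-1) 0 : 'cV[C]_2) = 1 by rewrite det2_cv2; ring.
have [a1 h1] : exists a, v1 = a *: (B *m cv2 1 0).
  apply: collinear_of_pclass_eq (unim _ _ e12) _.
  by rewrite rank1_mul rank1_e1 -act_pclass.
have [a2 h2] : exists a, v2 = a *: (B *m cv2 0 1).
  apply: collinear_of_pclass_eq (unim _ _ e21) _.
  by rewrite rank1_mul rank1_e2 -act_pclass.
have [a3 h3] := collinear_of_pclass_eq _ _ _ (unim _ _ (ew _)) p3.
have [a4 h4] := collinear_of_pclass_eq _ _ _ (unim _ _ (ew _)) p4.
have frame v v' a a' (b c b' c' : C) : v = a *: (B *m cv2 b c) ->
    v' = a' *: (B *m cv2 b' c') -> det2 v v' = a * a' * (\det B * (b * c' - c * b')).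
  by move=> -> ->; rewrite det2Z det2_mul det2_cv2.
rewrite (frame _ _ _ _ _ _ _ _ h1 h4) (frame _ _ _ _ _ _ _ _ h3 h2).
by rewrite (frame _ _ _ _ _ _ _ _ h4 h2) (frame _ _ _ _ _ _ _ _ h1 h3); ring.
Qed.

(** The frame has columns [v1] and [v2]; Cramer's rule gives the coordinates of the other two
    vertices in it. *)
Lemma edge_coords_det2 v1 v2 v3 v4 :
  0 < CLnormsq (det2 v1 v2) -> 0 < CLnormsq (det2 v1 v3) -> 0 < CLnormsq (det2 v1 v4) ->
  0 < CLnormsq (det2 v3 v2) -> 0 < CLnormsq (det2 v4 v2) ->
  edge_coords (pclass (rank1 v1)) (pclass (rank1 v2))
              (pclass (rank1 v3)) (pclass (rank1 v4))
    (det2 v3 v2 / det2 v1 v3) (det2 v4 v2 / det2 v1 v4).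
Proof.
move=> d12 d13 d14 d32 d42.
pose B : M2 := mx2 (v1 0 0) (v2 0 0) (v1 1 0) (v2 1 0).
have ord2 (P : 'I_2 -> Prop) : P 0 -> P 1 -> forall i, P i.
  by move=> P0 P1 [[|[|//]] h]; [rewrite (_ : Ordinal h = 0)|rewrite (_ : Ordinal h = 1)] => //;
    exact: val_inj.
have cancel (a a' d d' b x y : C) : a * a' = 1 -> d * d' = 1 ->
    a * d' * (b * a' * x + y) * d = b * x + a * y.
  by move=> aK dK; transitivity (d * d' * (a * a' * b * x + a * y)); [|rewrite aK dK]; ring.
have BE a b i : (B *m cv2 a b) i 0 = a * v1 i 0 + b * v2 i 0.
  by rewrite mulmx2E !cv2E !mxE /=; elim/ord2: i => /=; ring.
have B1 : B *m cv2 1 0 = v1.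
  by apply/matrixP => i j; rewrite ord1 BE; ring.
have B2 : B *m cv2 0 1 = v2.
  by apply/matrixP => i j; rewrite ord1 BE; ring.
have Bv v : 0 < CLnormsq (det2 v1 v) ->
    pclass (rank1 v) = pclass (rank1 (B *m cv2 (det2 v v2 / det2 v1 v) 1)).
  move=> dv; have dvU := CLnormsq_unit _ dv; have d12U := CLnormsq_unit _ d12.
  (* This factor is the coefficient of [v2] in [v]; dividing by it makes the second coordinate 1. *)
  rewrite -(pclass_rank1Z (det2 v1 v / det2 v1 v2) (B *m _)); last first.
    by rewrite gt_eqF // CLnormsqM mulr_gt0 // CLnormsq_inv_gt0.
  congr (pclass (rank1 _)); apply/matrixP => i j; rewrite ord1 mxE BE mul1r.
  apply: (mulIr d12U); rewrite cancel ?mulrV //.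
  by elim/ord2: i; rewrite /det2; ring.
exists B; split.
- rewrite /PGLp det2E !mxE /=; move: d12; rewrite /det2; congr (_ < CLnormsq _); ring.
- by rewrite -rank1_e1 act_pclass -rank1_mul B1.
- by rewrite -rank1_e2 act_pclass -rank1_mul B2.
- by split; apply: Bv.
- by split; rewrite CLnormsqM mulr_gt0 // CLnormsq_inv_gt0.
Qed.

End CrossRatios.

(** * Tetrahedra with vertices infinity, 0, 1, z *)

Section NormalForm.
Context {R : realType} {L : Lambda}.
Local Notation C := (CL R L).
Local Notation M2 := ('M[C]_2).
Implicit Types (B : M2) (w z : C) (p : ppoint R L) (I : set (ppoint R L)).

Definition corner z : 'I_4 -> 'cV[C]_2 :=
  tnth [tuple cv2 1 0; cv2 0 1; cv2 1 1; cv2 z 1].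

Definition ideal_simplex z : set (ppoint R L) := simplex (fun i => rank1 (corner z i)).

Lemma ideal_simplex_act B z : PGLp B ->
  simplex (fun i => rank1 (B *m corner z i)) = act B @` ideal_simplex z.
Proof.
move=> B0; rewrite /ideal_simplex -(simplex_act _ _ B0); congr simplex.
by apply/funext => i; exact: rank1_mul.
Qed.

Lemma ideal_simplex_conj z : ideal_simplex (CLconj z) = @conj_act R L @` ideal_simplex z.
Proof.
rewrite -simplex_conj; congr simplex; apply/funext => i; apply/matrixP => k l.
have E : corner (CLconj z) i = map_mx (@CLconj R L) (corner z i).
  apply/matrixP => m n; rewrite mxE /corner.
  by elim/ord4_ind: i; rewrite !tnth4E !mxE; case: ifP; rewrite ?rmorph0 ?rmorph1.
by rewrite [RHS]mxE !rank1E E !mxE rmorphM.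
Qed.

(* Two vertices of an ideal tetrahedron are joined by an edge in Y_Lambda, so
   their representatives must have the same sign. *)
Lemma edge_sign (y : 'I_4 -> M2) (i j : 'I_4) : lin_indep y -> i != j ->
  (forall b, cone_coef b -> ~ on_vertex_ray y (lincomb y b) ->
     Yspace (pclass (lincomb y b))) ->
  0 < rdet (y i + y j).
Proof.
move=> hy ij Yy; pose b k : R := (k == i)%:R + (k == j)%:R.
have Eb : lincomb y b = y i + y j by rewrite lincombD !lincomb_delta.
have b_ge0 k : 0 <= b k by rewrite /b; case: (k == i); case: (k == j) => /=; lra.
apply: rdet_gt0_of_Yspace; rewrite -Eb; apply: Yy.
  split=> //.
  rewrite gt_eqF // (bigD1 i) //= /b eqxx (negbTE ij) addr0 ltr_pwDl // sumr_ge0 //.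
move=> [k [r [r0]]]; rewrite -lincomb_delta rscale_lincomb => /(lincomb_inj _ _ _ hy) E.
have := E i; have := E j; rewrite /b !eqxx (negbTE ij) eq_sym (negbTE ij) add0r addr0.
have [<-|] := eqVneq i k; last by move=> _ _ /eqP; rewrite mulr0 oner_eq0.
by rewrite eq_sym (negbTE ij) mulr0 => /eqP; rewrite oner_eq0.
Qed.

(** A diagonal change of frame moves the third vertex to 1, the edges from the first vertex fix the
    signs of the representatives, and linear independence excludes a real [z]. *)
Lemma normal_form I p1 p2 p3 p4 w w' :
  ideal_tetrahedron I (vertices4 p1 p2 p3 p4) -> edge_coords p1 p2 p3 p4 w w' ->
  exists B z, [/\ PGLp B, cim z != 0, I = act B @` ideal_simplex z &
    forall i, vertices4 p1 p2 p3 p4 i = pclass (rank1 (B *m corner z i))].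
Proof.
move=> [y [py hy Yy IE _]] [B0 [B0_0 E1 E2 [E3 E4] [w0 w'0]]].
(* diag(w, 1) fixes infinity and 0 and sends 1 to [w] and [z] to [w']. *)
pose B := B0 *m mx2 w 0 0 1; pose z := w' / w.
have wU := CLnormsq_unit _ w0.
have detD : \det (mx2 w 0 0 1 : M2) = w by rewrite det2E !mxE /=; ring.
have PB : PGLp B by rewrite /PGLp det_mulmx detD CLnormsqM mulr_gt0.
have BE a b : B *m cv2 a b = B0 *m cv2 (w * a) b.
  rewrite -mulmxA; congr (_ *m _); apply/matrixP => i j.
  by rewrite ord1 mulmx2E !cv2E !mxE /=; case: ifP => _ /=; ring.
have vE i : vertices4 p1 p2 p3 p4 i = pclass (rank1 (B *m corner z i)).
  rewrite /vertices4 /corner; elim/ord4_ind: i; rewrite !tnth4E BE.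
  - have -> : cv2 (w * 1) 0 = w *: cv2 1 0 :> 'cV[C]_2.
      by apply/matrixP => i j; rewrite [RHS]mxE !mxE; case: ifP; rewrite ?mulr0.
    by rewrite -scalemxAr (pclass_rank1Z _ _ (lt0r_neq0 w0)) rank1_mul rank1_e1 E1 act_pclass.
  - by rewrite mulr0 rank1_mul rank1_e2 E2 act_pclass.
  - by rewrite [w * 1]mulr1.
  - by rewrite [w * z]mulrC /z (divrK wU).
have /choice[r rP] i : exists r, r != 0 /\ y i = rscale r (rank1 (B *m corner z i)).
  by have := (py i).2; rewrite vE => /esym /pclass_eqP[r r0 ?]; exists r.
(* The first corner has [det2] equal to 1 with each of the others, so the determinant at an edge
   point is [r 0 * r i] times [|det B|^2 > 0]. *)
have r0 i : 0 < r ord0 * r i.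
  have [<-|i0] := eqVneq ord0 i.
    by rewrite -expr2 lt_neqAle sqr_ge0 eq_sym sqrf_eq0 (rP _).1.
  have := edge_sign _ _ _ hy i0 Yy; rewrite !(rP _).2 rdet_add_rank1 det2_mul pmulr_lgt0 //.
  rewrite CLnormsqM mulr_gt0 //.
  rewrite (_ : det2 _ _ = 1) /CLnormsq /=; first by lra.
  move: i0; rewrite /corner; elim/ord4_ind: i => // _; rewrite !tnth4E det2_cv2; ring.
have yE : y = fun i => rscale (r i) (rank1 (B *m corner z i)).
  by apply/funext => i; exact: (rP i).2.
exists B, z; split=> //; last first.
  by rewrite IE yE (simplex_rescale _ _ _ r0) (ideal_simplex_act _ _ PB).
(* For real [z] all corners lie in the 3-dimensional space of real symmetric matrices; [b] is the
   resulting linear relation, with last coefficient -1. *)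
apply/eqP => z0; pose x := cre z.
pose b := tnth [tuple x ^+ 2 - x; 1 - x; x; -1].
suff b0 : lincomb (fun i => rank1 (corner z i)) b = 0.
  have /hy/(_ ord_max)/eqP : lincomb y (fun i => b i / r i) = 0.
    rewrite yE lincomb_rscale -[RHS](mul0mx _ (dagger B)) -[0 in RHS](mulmx0 _ B) -b0.
    rewrite -lincomb_mul; congr lincomb; apply/funext => i; first exact: rank1_mul.
    by rewrite divfK // (rP i).1.
  by rewrite mulf_eq0 invr_eq0 (negbTE (rP _).1) orbF /b (_ : tnth _ _ = -1) // oppr_eq0 oner_eq0.
rewrite /lincomb sum_ord4 /b /corner !tnth4E.
have -> : z = CLreal L x by rewrite /x; apply: CL_eq.
apply/matrixP => i j.
have entry (u1 u2 u3 u4 : 'cV[C]_2) (s1 s2 s3 s4 : R) :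
    (rscale s1 (rank1 u1) + rscale s2 (rank1 u2) + rscale s3 (rank1 u3)
       + rscale s4 (rank1 u4)) i j
    = CLreal L s1 * (u1 i 0 * CLconj (u1 j 0)) + CLreal L s2 * (u2 i 0 * CLconj (u2 j 0))
      + CLreal L s3 * (u3 i 0 * CLconj (u3 j 0)) + CLreal L s4 * (u4 i 0 * CLconj (u4 j 0)).
  rewrite mxE [X in X + _]mxE [X in X + _ + _]mxE -!rank1E.
  by congr (_ + _ + _ + _); rewrite mxE.
rewrite entry !cv2E [RHS]mxE.
by case: ifP => _; case: ifP => _; apply: CL_eq => /=; ring.
Qed.

Lemma interior_angle_polar (v1 v2 v3 v4 : 'cV[C]_2) a :
  interior_angle (pclass (rank1 v1)) (pclass (rank1 v2))
                 (pclass (rank1 v3)) (pclass (rank1 v4)) a ->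
  exists r f, [/\ 0 < r, L = Lam1 -> `|f| < pi, a = `|f| &
    (CLreal L r * expl L f) * (det2 v1 v4 * det2 v3 v2) = det2 v4 v2 * det2 v1 v3].
Proof.
move=> [r [f [[w [w' [cw E]]] r0 fpi ->]]]; exists r, f; split=> //.
have [B [_ _ _ _ [w0 _]]] := cw; have wU := CLnormsq_unit _ w0.
apply: (mulrI wU); rewrite -(cross_ratio_unique _ _ _ _ _ _ cw) -E !mulrA.
by rewrite [w * w']mulrC mulrK.
Qed.

End NormalForm.

(** * Reading the angles from the cross ratios *)

Section Angles.
Context {R : realType} {L : Lambda}.
Local Notation C := (CL R L).
Implicit Types (w z : C) (p q : ppoint R L) (I : set (ppoint R L)).

Lemma edge_coords_sym p q p' q' w w' :
  edge_coords p q p' q' w w' -> edge_coords p q q' p' w' w.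
Proof. by move=> [B [? ? ? [? ?] [? ?]]]; exists B. Qed.

(** Both sides of the cross ratio identity contain the unit [(det B)^2]; cancelling it leaves the
    coordinates of the model vertices. *)
Lemma interior_angle_frame (B : 'M[C]_2) (x1 y1 x2 y2 x3 y3 x4 y4 : C) a : PGLp B ->
  interior_angle (pclass (rank1 (B *m cv2 x1 y1))) (pclass (rank1 (B *m cv2 x2 y2)))
                 (pclass (rank1 (B *m cv2 x3 y3))) (pclass (rank1 (B *m cv2 x4 y4))) a ->
  exists r f, [/\ 0 < r, L = Lam1 -> `|f| < pi, a = `|f| &
    (CLreal L r * expl L f) * ((x1 * y4 - y1 * x4) * (x3 * y2 - y3 * x2))
    = (x4 * y2 - y4 * x2) * (x1 * y3 - y1 * x3)].
Proof.
move=> PB /interior_angle_polar[r [f [r0 fpi -> E]]]; exists r, f; split=> //.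
have DU : \det B \is a GRing.unit := CLnormsq_unit _ PB.
have frame (x y x' y' : C) :
    det2 (B *m cv2 x y) (B *m cv2 x' y') = \det B * (x * y' - y * x').
  by rewrite det2_mul det2_cv2.
move: E; rewrite 4!frame; set X := CLreal L r * _ => E.
apply: (mulrI DU); apply: (mulrI DU).
transitivity (X * (\det B * (x1 * y4 - y1 * x4) * (\det B * (x3 * y2 - y3 * x2)))).
  by ring.
by rewrite E; ring.
Qed.

Lemma tetrahedron_classification I p1 p2 p3 p4 w w' a a' b b' :
  ideal_tetrahedron I (vertices4 p1 p2 p3 p4) -> edge_coords p1 p2 p3 p4 w w' ->
  interior_angle p1 p3 p2 p4 a -> interior_angle p2 p4 p1 p3 a' ->
  interior_angle p1 p4 p2 p3 b -> interior_angle p2 p3 p1 p4 b' ->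
  [/\ a = a', b = b', isometric I (ideal_simplex (apex a b)) &
      isometric (ideal_simplex (apex a b)) I].
Proof.
move=> tI cI; have [B [z [PB imz IE vE]]] := normal_form _ _ _ _ _ _ _ tI cI.
have := vE (@Ordinal 4 0 isT); have := vE (@Ordinal 4 1 isT).
have := vE (@Ordinal 4 2 isT); have := vE (@Ordinal 4 3 isT).
rewrite /vertices4 /corner !tnth4E => -> -> -> -> H1 H1' H2 H2'.
have [r1 [f1 [r1_0 f1pi -> E1]]] := interior_angle_frame _ _ _ _ _ _ _ _ _ _ PB H1.
have [r1' [f1' [r1'_0 f1'pi -> E1']]] := interior_angle_frame _ _ _ _ _ _ _ _ _ _ PB H1'.
have [r2 [f2 [r2_0 f2pi -> E2]]] := interior_angle_frame _ _ _ _ _ _ _ _ _ _ PB H2.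
have [r2' [f2' [r2'_0 f2'pi -> E2']]] := interior_angle_frame _ _ _ _ _ _ _ _ _ _ PB H2'.
move: E1 E1' E2 E2'; set X1 := _ * expl L f1; set X1' := _ * expl L f1'.
set X2 := _ * expl L f2; set X2' := _ * expl L f2' => E1 E1' E2 E2'.
(* Opposite edges have the same cross ratio: [1 - z] for the first pair, [(z - 1)/z], multiplied
   out, for the second. *)
have {}E1 : 1 - z = X1.
  by transitivity (- ((z * 1 - 1 * 1) * (1 * 1 - 0 * 0))); [ring | rewrite -E1; ring].
have {}E1' : 1 - z = X1'.
  by transitivity (- ((1 * 1 - 1 * z) * (0 * 0 - 1 * 1))); [ring | rewrite -E1'; ring].
have {}E2 : z - 1 = z * X2.
  by transitivity (- ((1 * 1 - 1 * z) * (1 * 1 - 0 * 0))); [ring | rewrite -E2; ring].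
have {}E2' : z - 1 = z * X2'.
  by transitivity (- ((z * 1 - 1 * 1) * (0 * 0 - 1 * 1))); [ring | rewrite -E2'; ring].
have EX1 : X1 = X1' by rewrite -E1.
have EX2 : X2 = X2'.
  (* [1 - X2] inverts [z], which allows cancelling [z] in [z * X2 = z * X2']. *)
  have zX : z * (1 - X2) = 1 by rewrite mulrBr mulr1 -E2; ring.
  transitivity (z * X2 * (1 - X2)); first by rewrite -{1}[X2]mulr1 -{1}zX; ring.
  by rewrite -E2 E2' -[RHS]mulr1 -[in RHS]zX; ring.
split; first exact: polar_angle_unique EX1.
- exact: polar_angle_unique EX2.
- have [Ez|Ez] := apex_of_angles _ _ _ _ _ imz r1_0 r2_0 f1pi f2pi E1 E2.
    by rewrite IE -Ez; exact: (isometric_act _ _ PB).2.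
  (* In the conjugate case entrywise conjugation carries the simplex of [z] to that of the apex. *)
  apply: isometric_trans (isometric_conj _).2; rewrite -ideal_simplex_conj -Ez IE.
  exact: (isometric_act _ _ PB).2.
- have [Ez|Ez] := apex_of_angles _ _ _ _ _ imz r1_0 r2_0 f1pi f2pi E1 E2.
    by rewrite IE -Ez; exact: (isometric_act _ _ PB).1.
  apply: isometric_trans (isometric_conj _).1 _; rewrite -ideal_simplex_conj -Ez IE.
  exact: (isometric_act _ _ PB).1.
Qed.

Lemma edge_polar_det2 (v1 v2 v3 v4 : 'cV[C]_2) rho phi :
  0 < CLnormsq (det2 v1 v2) -> 0 < CLnormsq (det2 v1 v3) -> 0 < CLnormsq (det2 v1 v4) ->
  0 < CLnormsq (det2 v3 v2) -> 0 < CLnormsq (det2 v4 v2) ->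
  (CLreal L rho * expl L phi) * (det2 v1 v4 * det2 v3 v2) = det2 v4 v2 * det2 v1 v3 ->
  edge_polar (pclass (rank1 v1)) (pclass (rank1 v2))
             (pclass (rank1 v3)) (pclass (rank1 v4)) rho phi.
Proof.
move=> d12 d13 d14 d32 d42 E.
exists (det2 v3 v2 / det2 v1 v3), (det2 v4 v2 / det2 v1 v4); split.
  exact: edge_coords_det2.
have [U13 U14] := (CLnormsq_unit _ d13, CLnormsq_unit _ d14).
have U32 := CLnormsq_unit _ d32.
rewrite invrM ?unitrV // invrK mulrACA -E; set X := CLreal L rho * _.
rewrite -[RHS]mulr1 -[RHS]mulr1 -{1}(divrr U14) -(divrr U32); ring.
Qed.

End Angles.

(** * Exterior angles and both halves of the corollary *)

Lemma exterior_angle_polar (R : realType) (L : Lambda) (p q p' q' : ppoint R L) rho phi :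
  rho < 0 -> 0 < phi -> (L = Lam1 -> phi < pi) ->
  edge_polar p q p' q' rho phi -> exterior_angle p q p' q' phi.
Proof.
move=> rho0 phi0; case: L p q p' q' => p q p' q' phipi polar.
- by exists rho, phi; split=> //; rewrite gtr0_norm.
- by exists rho, phi; split=> //; rewrite gtr0_norm.
have phi_pi : phi - pi < 0 by rewrite subr_lt0 phipi.
(* A half turn absorbs the sign: [rho e^(l phi) = (- rho) e^(l (phi - pi))], so the interior angle
   is [pi - phi]. *)
exists `|phi - pi|; last by rewrite ltr0_norm // opprB; ring.
exists (- rho), (phi - pi); split=> //; last 2 first.
- by rewrite oppr_gt0.
- by move=> _; rewrite ltr0_norm //; lra.
move: polar => [w [w' [cw E]]]; exists w, w'; split=> //; rewrite E.
by apply: CL_eq => /=; rewrite cosB sinB cospi sinpi; ring.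
Qed.

(** The frame at an edge carrying an exterior angle is the starting point of [normal_form]. *)
Lemma edge_coords_of_exterior (R : realType) (L : Lambda) (p q p' q' : ppoint R L) c :
  exterior_angle p q p' q' c -> exists w w', edge_coords p q p' q' w w'.
Proof.
case: L p q p' q' => p q p' q'.
- by move=> [r [f [[w [w' [cw _]]] _ _]]]; exists w, w'.
- by move=> [r [f [[w [w' [cw _]]] _ _]]]; exists w, w'.
- by move=> [_ [r [f [[w [w' [cw _]]] _ _ _]]] _]; exists w, w'.
Qed.

Lemma perm_eq_pairs (T : eqType) (a b c d : T) :
  perm_eq [:: a; a; b; b] [:: c; c; d; d] -> a = c /\ b = d \/ a = d /\ b = c.
Proof.
move=> E; have : a \in [:: c; c; d; d] by rewrite -(perm_mem E) mem_head.
rewrite !inE orbA orbb orbb => /orP[/eqP ac|/eqP ad]; [left|right]; split=> //.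
  move: E; rewrite ac !perm_cons => /perm_mem/(_ b).
  by rewrite !inE eqxx !orbb => /esym/eqP.
have : perm_eq [:: a; a; b; b] ([:: d; d] ++ [:: c; c]) by rewrite perm_sym perm_catC perm_sym.
rewrite ad /= !perm_cons => /perm_mem/(_ b).
by rewrite !inE eqxx !orbb => /esym/eqP.
Qed.

(** The second order of [a] and [b] comes from exchanging the last two vertices; having both lets
    interior angles be compared as unordered data. *)
Lemma tetrahedron_normal_form (R : realType) (L : Lambda) (I : set (ppoint R L))
    (a a' b b' c c' : R) :
  gen_dihedral_angles I a a' b b' c c' ->
  [/\ a = a', b = b',
      isometric I (ideal_simplex (apex a b)) /\ isometric (ideal_simplex (apex a b)) I &
      isometric I (ideal_simplex (apex b a)) /\ isometric (ideal_simplex (apex b a)) I].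
Proof.
move=> [p1 [p2 [p3 [p4 [tI [i13 i24] [i14 i23] [+ _] _]]]]].
move=> /edge_coords_of_exterior[w [w' cw]].
have [aa' bb' I1 I2] := tetrahedron_classification _ _ _ _ _ _ _ _ _ _ _ tI cw i13 i24 i14 i23.
have [_ _ I3 I4] := tetrahedron_classification _ _ _ _ _ _ _ _ _ _ _
  (ideal_tetrahedron_swap _ _ _ _ _ tI) (edge_coords_sym _ _ _ _ _ _ cw) i14 i23 i13 i24.
by split.
Qed.

(** The polar forms of [1 - z], [(z - 1)/z] and [1/z] are explicit for an apex, and these are the
    cross ratios at the three pairs of opposite edges. *)
Lemma dihedral_angles_apex (R : realType) (L : Lambda) (alpha beta : R) (I : set (ppoint R L))
    (z := apex beta alpha : CL R L) :
  0 < alpha -> 0 < beta -> (L = Lam1 -> alpha + beta < pi) ->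
  ideal_tetrahedron I (vertices4 (pclass (rank1 (cv2 1 0))) (pclass (rank1 (cv2 0 1)))
                                 (pclass (rank1 (cv2 1 1))) (pclass (rank1 (cv2 z 1)))) ->
  gen_dihedral_angles I alpha alpha beta beta (alpha + beta) (alpha + beta).
Proof.
move=> al0 be0 sum_pi tI.
have al_pi : L = Lam1 -> alpha < pi by move=> /sum_pi; lra.
have be_pi : L = Lam1 -> beta < pi by move=> /sum_pi; lra.
have sal := sL_gt0 _ al0 al_pi; have sbe := sL_gt0 _ be0 be_pi.
have ssum : 0 < sL L (alpha + beta) by apply: sL_gt0 => //; rewrite addr_gt0.
have polar_norm (r f : R) : r != 0 -> 0 < CLnormsq (CLreal L r * expl L f).
  move=> r0; rewrite CLnormsqM CLnormsq_real CLnormsq_expl mulr1.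
  by rewrite lt_neqAle sqr_ge0 eq_sym sqrf_eq0 r0.
have normN (x : CL R L) : CLnormsq (- x) = CLnormsq x by rewrite /CLnormsq /=; ring.
have E1 : 1 - z = CLreal L (sL L (alpha + beta) / sL L alpha) * expl L (- beta).
  by rewrite sub1_apex ?gt_eqF // addrC.
have E2 : z - 1 = z * (CLreal L (sL L (alpha + beta) / sL L beta) * expl L alpha).
  by rewrite apex_sub1 ?gt_eqF // addrC.
have E3 : CLreal L (- (sL L alpha / sL L beta)) * expl L (alpha + beta) * z = 1.
  rewrite /z /apex mulrACA -CLrealM [beta + alpha]addrC explNK mulr1.
  by apply: CL_eq => //=; field; rewrite !gt_eqF.
have nz : 0 < CLnormsq z by rewrite polar_norm // oppr_eq0 gt_eqF // divr_gt0.
have n1 : 0 < CLnormsq (1 : CL R L) by rewrite /CLnormsq /=; lra.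
have n1z : 0 < CLnormsq (1 - z) by rewrite E1 polar_norm // gt_eqF // divr_gt0.
pose v1 : 'cV[CL R L]_2 := cv2 1 0; pose v2 : 'cV[CL R L]_2 := cv2 0 1.
pose v3 : 'cV[CL R L]_2 := cv2 1 1; pose v4 : 'cV[CL R L]_2 := cv2 z 1.
have d12 : det2 v1 v2 = 1 by rewrite det2_cv2; ring.
have d13 : det2 v1 v3 = 1 by rewrite det2_cv2; ring.
have d14 : det2 v1 v4 = 1 by rewrite det2_cv2; ring.
have d23 : det2 v2 v3 = - 1 by rewrite det2_cv2; ring.
have d24 : det2 v2 v4 = - z by rewrite det2_cv2; ring.
have d34 : det2 v3 v4 = 1 - z by rewrite det2_cv2; ring.
have det2C (u v : 'cV[CL R L]_2) : det2 u v = - det2 v u by rewrite /det2; ring.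
have d21 := etrans (det2C v2 v1) (congr1 -%R d12).
have d31 := etrans (det2C v3 v1) (congr1 -%R d13).
have d41 := etrans (det2C v4 v1) (congr1 -%R d14).
have d32 := etrans (det2C v3 v2) (congr1 -%R d23).
have d42 := etrans (det2C v4 v2) (congr1 -%R d24).
have d43 := etrans (det2C v4 v3) (congr1 -%R d34).
(* In [apex beta alpha] the angle at 1 is [beta] and the one at z is [alpha]. Listing z third puts
   [alpha] first and makes the exterior cross ratio [1/z], with positive phase [alpha + beta]. *)
move: tI => /ideal_tetrahedron_swap; rewrite -/v1 -/v2 -/v3 -/v4.
clearbody v1 v2 v3 v4 => tI.
have dE := (d12, d13, d14, d23, d24, d34, (d21, d31, d41, d32, d42, d43), normN).
exists (pclass (rank1 v1)), (pclass (rank1 v2)), (pclass (rank1 v4)), (pclass (rank1 v3)).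
have int_al (p q p' q' : ppoint R L) :
    edge_polar p q p' q' (sL L (alpha + beta) / sL L beta) alpha -> interior_angle p q p' q' alpha.
  move=> polar; exists (sL L (alpha + beta) / sL L beta), alpha.
  by split; rewrite ?gtr0_norm ?divr_gt0 //; exact: al_pi.
have int_be (p q p' q' : ppoint R L) :
    edge_polar p q p' q' (sL L (alpha + beta) / sL L alpha) (- beta) ->
    interior_angle p q p' q' beta.
  move=> polar; exists (sL L (alpha + beta) / sL L alpha), (- beta).
  by split; rewrite ?normrN ?gtr0_norm ?divr_gt0 //; exact: be_pi.
have ext (p q p' q' : ppoint R L) :
    edge_polar p q p' q' (- (sL L alpha / sL L beta)) (alpha + beta) ->
    exterior_angle p q p' q' (alpha + beta).
  apply: exterior_angle_polar => //; first by rewrite oppr_lt0 divr_gt0.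
  by rewrite addr_gt0.
split=> //.
- split; apply: int_al; apply: edge_polar_det2; rewrite ?dE //.
  + by transitivity (- (z * (CLreal L (sL L (alpha + beta) / sL L beta) * expl L alpha)));
      [ring | rewrite -E2; ring].
  + by transitivity (- (z * (CLreal L (sL L (alpha + beta) / sL L beta) * expl L alpha)));
      [ring | rewrite -E2; ring].
- by split; apply: int_be; apply: edge_polar_det2; rewrite ?dE // -E1; ring.
- split; apply: ext; apply: edge_polar_det2; rewrite ?dE //.
  + by rewrite opprK mul1r E3; ring.
  + by rewrite opprK mulr1 E3; ring.
- move=> x y; rewrite !inE !orbb => /or3P[]/eqP-> /eqP->; lra.
Qed.

Theorem corollary4p16 (R : realType) (L : Lambda) :
  (forall (I J : set (ppoint R L)) (a1 a1' b1 b1' c1 c1' a2 a2' b2 b2' c2 c2' : R),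
      gen_dihedral_angles I a1 a1' b1 b1' c1 c1' ->
      gen_dihedral_angles J a2 a2' b2 b2' c2 c2' ->
      perm_eq [:: a1; a1'; b1; b1'] [:: a2; a2'; b2; b2'] ->
      perm_eq [:: c1; c1'] [:: c2; c2'] ->
      isometric I J)
  /\
  (forall (alpha beta gamma : R) (z : CL R L) (I : set (ppoint R L)),
      0 < alpha -> 0 < beta -> gamma = - (alpha + beta) ->
      (L = Lam1 -> alpha + beta < pi) ->
      z = CLreal L (- (sL L beta / sL L alpha)) * expl L gamma ->
      ideal_tetrahedron I
        (vertices4 (pclass (mx2 1 0 0 0)) (pclass (mx2 0 0 0 1))
                   (pclass (mx2 1 1 1 1))
                   (pclass (mx2 (CLreal L (CLnormsq z)) z (CLconj z) 1))) ->
      gen_dihedral_angles I alpha alpha beta beta (alpha + beta) (alpha + beta)).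
Proof.
split=> [I J a1 a1' b1 b1' c1 c1' a2 a2' b2 b2' c2 c2'|].
  (* The interior angles match in the given or in the exchanged order; the two normal forms of [J]
     serve these two cases. *)
  move=> /tetrahedron_normal_form[<- <- [I1 _] _].
  move=> /tetrahedron_normal_form[<- <- [_ J1] [_ J2]].
  move=> /perm_eq_pairs[[ea eb]|[ea eb]] _; apply: isometric_trans I1 _.
    by rewrite ea eb.
  by rewrite ea eb.
move=> al be ga z I al0 be0 -> sum_pi zE tI.
apply: (dihedral_angles_apex _ _ _ _ _ al0 be0 sum_pi).
have Ez : apex be al = z by rewrite zE /apex addrC.
have E1 : mx2 1 1 1 1 = rank1 (cv2 1 1) :> 'M[CL R L]_2.
  by rewrite rank1_cv2; congr mx2; apply: CL_eq; rewrite /CLnormsq /=; ring.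
have Ez4 : mx2 (CLreal L (CLnormsq z)) z (CLconj z) 1 = rank1 (cv2 z 1).
  by rewrite rank1_cv2; congr mx2; apply: CL_eq; rewrite /CLnormsq /=; ring.
by rewrite Ez; move: tI; rewrite E1 Ez4 rank1_e1 rank1_e2.
Qed.
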